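(* Let $|\varphi\rangle$ and $|\psi\rangle$ be two $N$-partite pure states over $H=\bigotimes_{i=1}^NH_i$ with $\dim H_i=d_i$, with coefficient tensors $\mathcal{X}$ and $\mathcal{X}'$ and mode-$i$ matricizations $X_{(i)}$ and $X'_{(i)}$ respectively. Then $|\varphi\rangle$ and $|\psi\rangle$ are LU equivalent if and only if there exist unitary $d_i\times d_i$ matrices $U_i$ ($i=1,\dots,N$) such that $$X_{(i)}=U_i\,X'_{(i)}\,(U_N\otimes\cdots\otimes U_{i+1}\otimes U_{i-1}\otimes\cdots\otimes U_1)^{\mathrm t}\qquad(i=1,\dots,N).$$
   Context: Each $H_t$ is a complex Hilbert space of finite dimension $d_t$ with a fixed orthonormal basis $|1\rangle,\dots,|d_t\rangle$. A pure state is a unit vector $\sum_{j_1,\dots,j_N}\alpha_{j_1\cdots j_N}|j_1\cdots j_N\rangle$ of $H$, and its coefficient tensor is the array $(\alpha_{j_1\cdots j_N})\in\mathbb{C}^{d_1\times\cdots\times d_N}$. Two pure states $|\varphi\rangle,|\psi\rangle$ are LU (local unitary) equivalent if $|\varphi\rangle=(U_1\otimes\cdots\otimes U_N)|\psi\rangle$ for some unitary operators $U_i$ on $H_i$. The mode-$n$ matricization $X_{(n)}$ of a tensor $\mathcal{X}=(x_{i_1\cdots i_N})$ of size $d_1\times\cdots\times d_N$ is the $d_n\times\prod_{m\ne n}d_m$ matrix whose $(i_n,j)$ entry is $x_{i_1\cdots i_N}$, where $j=1+\sum_{k\neq n}(i_k-1)\beta_k$ and $\beta_k=\prod_{m<k,\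 m\neq n}d_m$. The symbol $\otimes$ between matrices is the Kronecker product, and $\mathrm t$ denotes transpose (without conjugation). *)

(* Defs.v *)
From HB Require Import structures.
From mathcomp Require Import all_boot all_order all_algebra.
From mathcomp Require Import reals.
From mathcomp Require Export complex mxtens.

Set Implicit Arguments.
Unset Strict Implicit.
Unset Printing Implicit Defensive.

Import Order.TTheory GRing.Theory Num.Theory.
Local Open Scope ring_scope.

(* Indices are 0-based: i_k ranges over 0, ..., d_k - 1, and the parties are
   0, ..., N - 1. *)
Definition midx (N : nat) (d : 'I_N -> nat) : finType :=
  {dffun forall k : 'I_N, 'I_(d k)}.

(* A vector of H = H_0 (x) ... (x) H_(N-1) is given by its coefficients in the
   product basis |j_0 ... j_(N-1)>, i.e. it is its own coefficient tensor. *)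
Definition tensor (C : Type) (N : nat) (d : 'I_N -> nat) : Type :=
  {ffun midx d -> C}.

Section States.

Variables (R : realType) (N : nat) (d : 'I_N -> nat).
Local Notation C := R[i].

Definition pure_state (psi : tensor C d) : Prop :=
  \sum_(j : midx d) `|psi j| ^+ 2 = 1.

(* The operator U_0 (x) ... (x) U_(N-1) of H: it is linear and sends
   |k_0 ... k_(N-1)> to U_0 |k_0> (x) ... (x) U_(N-1) |k_(N-1)>, whose
   coefficient at |j_0 ... j_(N-1)> is the product of the (U_t)_(j_t, k_t). *)
Definition tensor_op (U : forall t : 'I_N, 'M[C]_(d t)) (psi : tensor C d) :
    tensor C d :=
  [ffun j : midx d =>
     \sum_(k : midx d) psi k * \prod_(t < N) U t (j t) (k t)].

(* A unitary operator of H_t = C^(d t) is given by its matrix in the fixed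
   orthonormal basis. *)
Definition LU_equivalent (phi psi : tensor C d) : Prop :=
  exists U : forall t : 'I_N, 'M[C]_(d t),
    (forall t, U t \is unitarymx) /\ phi = tensor_op U psi.

End States.

Section Matricization.

Variables (N : nat) (d : 'I_N -> nat) (n : 'I_N).

Definition mstride (k : 'I_N) : nat :=
  (\prod_(m < N | (m < k) && (m != n)) d m)%N.

Definition mcol (i : midx d) : nat :=
  (\sum_(k < N | k != n) i k * mstride k)%N.

(* The entry in row r and column c is the coefficient at the multi-index i with
   i_n = r and column number c; matricizationE below shows that it is unique
   and that every multi-index is used. *)
Definition matricization (C : nzRingType) (X : tensor C d) :
    'M[C]_(d n, (\prod_(m < N | m != n) d m)%N) :=
  \matrix_(r, c)
    oapp X 0 [pick i : midx d | (i n == r) && (mcol i == c :> nat)].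

Lemma big_ltS (T : Type) (idx : T) (op : Monoid.com_law idx)
    (p : 'I_N) (F : 'I_N -> T) :
  \big[op/idx]_(k < N | (k < p.+1)%N && (k != n)) F k =
  op (if p != n then F p else idx)
     (\big[op/idx]_(k < N | (k < p)%N && (k != n)) F k).
Proof.
have lt_p (k : 'I_N) : (k < p.+1)%N && (k != p) = (k < p)%N.
  by rewrite ltnS [RHS]ltn_neqAle andbC.
case: (eqVneq p n) => [pn | pNn]; last first.
  rewrite (bigD1 p) /=; last by rewrite ltnSn.
  by congr (op _ _); apply: eq_bigl => k; rewrite andbAC lt_p.
rewrite Monoid.mul1m; apply: eq_bigl => k.
by rewrite -[X in _ = X && _]lt_p pn -andbA andbb.
Qed.

Lemma mcol_lt_prefix (i : midx d) (p : nat) : (p <= N)%N ->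
  (\sum_(k < N | (k < p)%N && (k != n)) i k * mstride k <
   \prod_(k < N | (k < p)%N && (k != n)) d k)%N.
Proof.
elim: p => [|p IHp] le_p; first by rewrite !big_pred0.
rewrite !(big_ltS _ (Ordinal le_p)) /=.
have {IHp} := IHp (ltnW le_p); case: ifP => _; last by rewrite add0n mul1n.
rewrite -/(mstride (Ordinal le_p)); set r := bigop.body _ _ _ => lt_r.
apply: (@leq_trans ((i (Ordinal le_p)).+1 * mstride (Ordinal le_p))%N).
  by rewrite mulSn addnC ltn_add2r.
by rewrite leq_mul2r ltn_ord orbT.
Qed.

Lemma mcol_lt (i : midx d) : (mcol i < \prod_(m < N | m != n) d m)%N.
Proof.
have := mcol_lt_prefix i (leqnn N).
rewrite (eq_bigl (fun k => k != n)) => [|k]; last by rewrite ltn_ord.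
by rewrite [X in (_ < X)%N](eq_bigl (fun k => k != n)) => [|k]; rewrite ?ltn_ord.
Qed.

Lemma mcol_inj_prefix (i i' : midx d) (p : nat) : (p <= N)%N ->
  (\sum_(k < N | (k < p)%N && (k != n)) i k * mstride k =
   \sum_(k < N | (k < p)%N && (k != n)) i' k * mstride k)%N ->
  forall k : 'I_N, (k < p)%N -> k != n -> i k = i' k.
Proof.
elim: p => [|p IHp] le_p //; rewrite !(big_ltS _ (Ordinal le_p)) /=.
have lt_i := mcol_lt_prefix i (ltnW le_p).
have lt_i' := mcol_lt_prefix i' (ltnW le_p).
have {IHp} := IHp (ltnW le_p).
move: lt_i lt_i'; rewrite -/(mstride (Ordinal le_p)).
set r := bigop.body _ _ _; set r' := bigop.body _ _ _ => lt_r lt_r' IHp E k.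
rewrite ltnS leq_eqVlt => /orP[/eqP kp kn | lt_kp kn]; last first.
  apply: IHp => //; move: E; case: ifP => _ //.
  by move/(congr1 (modn^~ (mstride (Ordinal le_p)))); rewrite !modnMDl !modn_small.
have {kp} kE : k = Ordinal le_p by apply: val_inj.
move: E; rewrite -kE kn => /(congr1 (divn^~ (mstride k))).
have s_gt0 : (0 < mstride k)%N by rewrite kE (leq_ltn_trans _ lt_r).
rewrite !divnMDl // !divn_small ?kE // !addn0 => E.
exact: val_inj.
Qed.

Lemma mcol_inj (i i' : midx d) : i n = i' n -> mcol i = mcol i' -> i = i'.
Proof.
move=> En Ecol; apply/ffunP => k; have [-> // | kn] := eqVneq k n.
apply: (mcol_inj_prefix (leqnn N)) => //.
rewrite (eq_bigl (fun k => k != n)) => [|j]; last by rewrite ltn_ord.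
by rewrite [RHS](eq_bigl (fun k => k != n)) => [|j]; rewrite ?ltn_ord.
Qed.

Lemma matricizationE (C : nzRingType) (X : tensor C d) (i : midx d) :
  matricization X (i n) (Ordinal (mcol_lt i)) = X i.
Proof.
rewrite mxE; case: pickP => [j /andP[/eqP En /eqP Ecol] | /(_ i)] /=.
  by rewrite (mcol_inj En Ecol).
by rewrite !eqxx.
Qed.

End Matricization.

Section Kronecker.

Variables (C : pzRingType) (N : nat) (d : 'I_N -> nat).
Variable U : forall t : 'I_N, 'M[C]_(d t).

Definition dim_seq (s : seq 'I_N) : nat :=
  foldr (fun t q => (d t * q)%N) 1%N s.

(* U_(s_1) (x) U_(s_2) (x) ... (x) [1] for s = [:: s_1; s_2; ...]. *)
Fixpoint kron_seq (s : seq 'I_N) : 'M[C]_(dim_seq s) :=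
  match s with
  | [::] => 1%:M
  | t :: s' => U t *t kron_seq s'
  end.

(* N - 1, ..., n + 1, n - 1, ..., 0 *)
Definition others_desc (n : 'I_N) : seq 'I_N :=
  rev [seq m <- enum 'I_N | m != n].

Lemma dim_others (n : 'I_N) :
  dim_seq (others_desc n) = (\prod_(m < N | m != n) d m)%N.
Proof.
have dim_seqE s : dim_seq s = (\prod_(t <- s) d t)%N.
  by elim: s => [|t s IHs] /=; rewrite ?big_nil ?big_cons ?IHs.
rewrite dim_seqE /others_desc (perm_big _ (permEl (perm_rev _))) /=.
by rewrite big_filter big_enum_cond.
Qed.

Definition kron_others (n : 'I_N) : 'M[C]_(\prod_(m < N | m != n) d m)%N :=
  castmx (dim_others n, dim_others n) (kron_seq (others_desc n)).

End Kronecker.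

(* Main.v *)
(** Each pair (row, column) of the mode-n matricization is (i_n, column number
    of i) for exactly one multi-index i, since i |-> (i_n, mcol i) is injective
    between finite sets of equal cardinality.  Moreover mcol i is the row index
    of U_N (x) ... (x) U_1 (without U_n) at which the Kronecker product reads
    off the digits of i, so the entry of that product at (mcol i, mcol k) is
    the product of the (U_t)_(i_t, k_t) over t != n.  Hence the matricization
    of (U_1 (x) ... (x) U_N) psi is U_n X'_(n) (...)^t, entry by entry, and one
    matricization already determines the tensor. *)
Require Import Defs.
From mathcomp Require Import all_boot all_order all_algebra.
From mathcomp Require Import reals complex.

Local Open Scope ring_scope.

Section MatricizationBijection.

Context {N : nat} {d : 'I_N -> nat} (n : 'I_N).

Definition midx_cell (i : midx d) :
    'I_(d n) * 'I_(\prod_(m < N | m != n) d m)%N :=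
  (i n, Ordinal (mcol_lt n i)).

Lemma midx_cell_inj : injective midx_cell.
Proof. by move=> i i' [] En /(mcol_inj En). Qed.

Lemma midx_cell_bij : bijective midx_cell.
Proof.
apply: inj_card_bij; first exact: midx_cell_inj.
rewrite card_prod !card_ord card_dep_ffun foldrE big_map big_enum /=.
rewrite [X in (_ <= X)%N](bigD1 n) //= card_ord.
by under [X in (_ <= _ * X)%N]eq_bigr do rewrite card_ord.
Qed.

Lemma matricization_cell {C : nzRingType} (X : tensor C d) (i : midx d) :
  matricization n X (midx_cell i).1 (midx_cell i).2 = X i.
Proof. exact: matricizationE. Qed.

Lemma matricization_inj {C : nzRingType} :
  injective (@matricization N d n C).
Proof.
by move=> X Y E; apply/ffunP => i; rewrite -matricization_cell E matricization_cell.
Qed.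

End MatricizationBijection.

Section KroneckerEntries.

Context {C : comPzRingType} {N : nat} {d : 'I_N -> nat}.
Variable U : forall t : 'I_N, 'M[C]_(d t).

(** Mixed-radix number with digits [i t], the head of [s] being the most significant digit, as in
    nested Kronecker products. *)
Fixpoint kron_index (i : midx d) (s : seq 'I_N) : 'I_(dim_seq d s) :=
  match s with
  | [::] => ord0
  | t :: s' => mxtens_index (i t, kron_index i s')
  end.

Lemma kron_seqE (i k : midx d) (s : seq 'I_N) :
  kron_seq U s (kron_index i s) (kron_index k s) =
  \prod_(t <- s) U t (i t) (k t).
Proof.
elim: s => [|t s IHs] /=; first by rewrite mxE eqxx big_nil.
by rewrite tensmxE IHs big_cons.
Qed.

Lemma dim_seqE (s : seq 'I_N) : dim_seq d s = (\prod_(t <- s) d t)%N.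
Proof. by elim: s => [|t s IHs] /=; rewrite ?big_nil ?big_cons ?IHs. Qed.

(** The place value of digit [t] is the product of the dimensions after [t] in [s]; when [s]
    decreases, these are exactly the parties below [t], as in [mstride]. *)
Lemma kron_index_sorted (i : midx d) (s : seq 'I_N) :
  sorted (fun t u : 'I_N => (u < t)%N) s ->
  kron_index i s = (\sum_(t <- s) i t * \prod_(m <- s | (m < t)%N) d m)%N :> nat.
Proof.
have gt_trans : transitive (fun t u : 'I_N => (u < t)%N).
  by move=> u t v /= ut vu; apply: ltn_trans vu ut.
elim: s => [|t s IHs] /=; first by rewrite big_nil.
rewrite (path_sortedE gt_trans) => /andP[/allP lt_t /IHs ->].
rewrite !big_cons ltnn dim_seqE; congr (_ * _ + _)%N.
  by rewrite [RHS]big_seq_cond [LHS]big_seq; apply: eq_bigl => m;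
    case: (boolP (m \in s)) => // /lt_t ->.
(* The head [t] exceeds every [u] in the tail, so it does not enter the place value of [u]. *)
rewrite big_seq [RHS]big_seq; apply: eq_bigr => u /lt_t lt_ut.
by rewrite big_cons ltnNge (ltnW lt_ut).
Qed.

Lemma big_others_desc {T : Type} {idx : T} (op : Monoid.com_law idx)
    (n : 'I_N) (P : pred 'I_N) (F : 'I_N -> T) :
  \big[op/idx]_(t <- others_desc n | P t) F t =
  \big[op/idx]_(t < N | (t != n) && P t) F t.
Proof.
rewrite /others_desc (perm_big _ (permEl (perm_rev _))) /=.
by rewrite big_filter_cond big_enum_cond.
Qed.

Lemma kron_index_others (n : 'I_N) (i : midx d) :
  kron_index i (others_desc n) = mcol n i :> nat.
Proof.
rewrite kron_index_sorted; last first.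
  rewrite /others_desc rev_sorted; apply: sorted_filter.
    by move=> u t v /=; apply: ltn_trans.
  by have := iota_ltn_sorted 0 N; rewrite -val_enum_ord sorted_map.
rewrite big_others_desc /mcol; apply: eq_big => [t|t _]; first by rewrite andbT.
by rewrite big_others_desc; congr (_ * _)%N; apply: eq_bigl => m; rewrite andbC.
Qed.

Lemma kron_othersE (n : 'I_N) (i k : midx d) :
  kron_others U n (midx_cell n i).2 (midx_cell n k).2 =
  \prod_(t < N | t != n) U t (i t) (k t).
Proof.
rewrite castmxE.
have cast_cell (j : midx d) : cast_ord (esym (dim_others d n))
    (midx_cell n j).2 = kron_index j (others_desc n).
  by apply: val_inj; rewrite /= kron_index_others.
rewrite !cast_cell kron_seqE big_others_desc.
by apply: eq_bigl => t; rewrite andbT.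
Qed.

End KroneckerEntries.

Lemma matricization_tensor_op {R : realType} {N : nat} {d : 'I_N -> nat}
    (U : forall t : 'I_N, 'M[R[i]]_(d t)) (psi : tensor R[i] d) (n : 'I_N) :
  matricization n (tensor_op U psi) =
  U n *m matricization n psi *m (kron_others U n)^T.
Proof.
have [f cellK fK] := midx_cell_bij n (d := d).
apply/matrixP => r c.
(* Exposing the pair [(r, c)] lets it be replaced by the cell of a multi-index [j]. *)
rewrite -[r]/((r, c).1) -[c in RHS]/((r, c).2) -[c in LHS]/((r, c).2).
rewrite -(fK (r, c)); set j := f _.
rewrite matricization_cell ffunE -mulmxA mxE.
under [RHS]eq_bigr do rewrite mxE big_distrr /=.
(* The double sum over rows and columns becomes the sum over multi-indices that defines
   [tensor_op]. *)
rewrite pair_big /= (reindex (midx_cell n)) /=; last first.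
  by exists f => x _; rewrite ?cellK ?fK.
apply: eq_bigr => k _.
rewrite matricization_cell [in RHS]mxE kron_othersE (bigD1 n) //=.
by rewrite GRing.mulrCA.
Qed.

Theorem mainTheorem6 (R : realType) (N : nat) (hN : (0 < N)%N)
    (d : 'I_N -> nat) (phi psi : tensor R[i] d)
    (hphi : pure_state phi) (hpsi : pure_state psi) :
  LU_equivalent phi psi <->
  exists U : forall t : 'I_N, 'M[R[i]]_(d t),
    (forall t, U t \is unitarymx) /\
    (forall n : 'I_N,
       matricization n phi = U n *m matricization n psi *m (kron_others U n)^T).
Proof.
split=> -[U [unitU E]]; exists U; split=> //.
  by move=> n; rewrite E matricization_tensor_op.
(* The equation for a single mode suffices; [hN] provides mode 0. *)
apply: (matricization_inj (Ordinal hN)).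
by rewrite matricization_tensor_op E.
Qed.
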